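(* Consider a discounted MDP with a single state, finite action set $\mathcal{A}$, rewards in $[0,1]$, and discount factor $\gamma\in(0,1)$. Let $(\pi_k)_{k\ge0}$ be the Natural Policy Gradient iterates with constant step size $\eta>0$ started from the uniform policy, and let $\Delta$ be the optimal advantage function gap. Then the convergence is lower bounded as follows: for all $K\ge0$, $$V^\star-V^{\pi_K}\ \ge\ \frac{\Delta}{(1-\gamma)|\mathcal{A}|}\,e^{-\eta\Delta K}.$$
   Context: Since there is a single state, it is suppressed from the notation. A policy $\pi$ is a probability distribution on $\mathcal{A}$. $\mathcal{R}(a)\in[0,1]$ is the (random) reward of action $a$ and $r(a)=\mathbb{E}[\mathcal{R}(a)]$. $V^\pi=\mathbb{E}[\sum_{t\ge0}\gamma^t\mathcal{R}(A_t)]$ with $A_t\sim\pi$; $Q^\pi(a)=r(a)+\gamma V^\pi$; $A^\pi(a)=Q^\pi(a)-V^\pi$. $V^\star,Q^\star,A^\star$ denote these quantities for an optimal policy, and $\mathcal{A}^\star=\operatorname{arg\,max}_aQ^\star(a)$. The optimal advantage function gap is $\Delta=-\max_{a\notin\mathcal{A}^\star}A^\star(a)$, which equals $r^\star-\max_{a\notin\mathcal{A}^\star}r(a)$ with $r^\star=\max_ar(a)$; by convention $\Delta=\infty$ if every action is optimal ($A^\star(a)=0$ for all $a$). NPG with constant step size $\eta$: $\pi_0(a)=1/|\mathcal{A}|$ for all $a$, and $$\pi_{k+1}(a)=\frac{\pi_k(a)\exp(\eta Q^{\pi_k}(a))}{\sum_{a'}\pi_k(a')\exp(\eta Q^{\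pi_k}(a'))}.$$
   Formalization: The case K = 0 with every action optimal (Δ = ∞) is excluded, since there the bound would read 0 ≥ ∞; for Δ = ∞ and K ≥ 1 the right-hand side is read as 0. *)

(* Defs.v *)
From HB Require Import structures.
From mathcomp Require Import all_boot all_order all_algebra.
From mathcomp Require Import all_classical all_reals all_analysis.

Set Implicit Arguments.
Unset Strict Implicit.
Unset Printing Implicit Defensive.

Import Order.TTheory GRing.Theory Num.Theory.
Import numFieldNormedType.Exports.

Local Open Scope classical_set_scope.
Local Open Scope ring_scope.

(* Single-state discounted MDP: [reward_law a] is the law of the random reward
   R(a). *)
Record mdp (R : realType) (A : finType) := MDP {
  discount : R;
  discount_gt0 : 0 < discount;
  discount_lt1 : discount < 1;
  reward_law : A -> probability (measurableTypeR R) R;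
  reward_law01 : forall a, reward_law a [set` `[0, 1]] = 1%E
}.

(* The sum condition forces [A] to be nonempty as soon as a policy exists. *)
Record policy (R : realType) (A : finType) := Policy {
  action_prob :> A -> R;
  action_prob_ge0 : forall a, 0 <= action_prob a;
  action_prob_sum1 : \sum_a action_prob a = 1
}.

(* A sample space [W] with action and reward processes [A_t], [R_t = R(A_t)],
   and for each policy [p] a probability [traj_prob p] under which the pairs
   [(A_t, R_t)] are i.i.d. in [t], with [A_t] of law [p] and [R_t] of law
   [reward_law a] given [A_t = a].  [W] can be taken to be the space of
   trajectories, with the measures given by the Ionescu-Tulcea theorem. *)
Record trajectories (R : realType) (A : finType) (M : mdp R A)
    (d : measure_display) (W : measurableType d) := Trajectories {
  act : nat -> W -> A;
  act_measurable : forall t a, measurable (act t @^-1` [set a]);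
  rew : nat -> {mfun W >-> measurableTypeR R};
  rew_ge0 : forall t w, 0 <= rew t w;
  rew_le1 : forall t w, rew t w <= 1;
  traj_prob : policy R A -> probability W R;
  traj_law : forall (p : policy R A) (n : nat) (a : nat -> A)
      (B : nat -> set (measurableTypeR R)),
    (forall t, measurable (B t)) ->
    traj_prob p (\bigcap_(t < n) [set w | act t w = a t /\ B t (rew t w)])
    = (\prod_(t < n) (p (a t) * fine (reward_law M (a t) (B t))))%:E
}.

Section quantities.
Context (R : realType) (A : finType) (M : mdp R A).
Context (d : measure_display) (W : measurableType d) (X : trajectories M W).
Implicit Types (p : policy R A) (a : A).

Definition mean_reward a : R :=
  fine ('E_(reward_law M a)[fun x : measurableTypeR R => (x : R)]).

Definition discounted_return (w : W) : R :=
  limn (series (fun t => discount M ^+ t * rew X t w)).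

Definition V p : R := fine ('E_(traj_prob X p)[discounted_return]).

Definition Q p a : R := mean_reward a + discount M * V p.

Definition advantage p a : R := Q p a - V p.

Definition optimal p : Prop := forall p', V p' <= V p.

(* argmax_a Q^p(a) *)
Definition greedy p : {pred A} := [pred a | [forall b, Q p b <= Q p a]].

(* For [p] optimal this is Delta.  The maximum over the empty set is -oo, so
   that the gap is +oo when every action is optimal. *)
Definition gap p : \bar R :=
  (- \big[maxe/-oo]_(a | a \notin greedy p) (advantage p a)%:E)%E.

Definition npg (eta : R) (pi : nat -> policy R A) : Prop :=
  (forall a, pi 0%N a = #|A|%:R^-1) /\
  (forall k a, pi k.+1 a =
    pi k a * expR (eta * Q (pi k) a)
    / (\sum_a' pi k a' * expR (eta * Q (pi k) a'))).

End quantities.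

(* Main.v *)
Require Import Defs.
From HB Require Import structures.
From mathcomp Require Import all_boot all_order all_algebra.
From mathcomp Require Import all_classical all_reals all_analysis.
From mathcomp Require Import measurable_realfun ring.
Import Order.TTheory GRing.Theory Num.Theory.
Import numFieldNormedType.Exports.
Local Open Scope classical_set_scope.
Local Open Scope ring_scope.

(* The law of the t-th reward under a policy p is the p-mixture of the reward
   laws, so V^p is the p-average of the mean rewards divided by 1 - gamma; in
   particular V^p is affine in p, and Vmax - V^p dominates the contribution
   p(a) (rmax - r(a)) / (1 - gamma) of any single action a.  In the NPG update
   the common term gamma V^{pi_k} of Q^{pi_k} cancels, so that pi_k(a) is
   proportional to exp(eta k r(a)), and the normalising sum is at most
   |A| exp(eta k rmax); hence pi_k(a) >= exp(-eta k (rmax - r(a))) / |A|.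
   Taking for a a best suboptimal action, for which rmax - r(a) = Delta, gives the
   bound. *)

(** On [D], [mu] agrees with the finite sum of the measures [nu a] scaled by [c a], and the integral
    is additive and homogeneous in the measure. *)
Lemma ge0_integral_mixture {d} {T : measurableType d} {R : realType}
    {A : finType} (c : A -> {nonneg R}) (mu : {measure set T -> \bar R})
    (nu : A -> {measure set T -> \bar R}) (D : set T) (f : T -> \bar R) :
  measurable D -> (forall x, D x -> (0 <= f x)%E) -> measurable_fun D f ->
  (forall B, measurable B -> B `<=` D ->
     mu B = (\sum_a (c a)%:num%:E * nu a B)%E) ->
  (\int[mu]_(x in D) f x = \sum_a (c a)%:num%:E * \int[nu a]_(x in D) f x)%E.
Proof.
move=> mD f0 mf muE.
(* [msum] takes a sequence indexed by naturals, so the scaled measures are listed along [enum A]. *)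
pose s : seq {measure set T -> \bar R} :=
  [seq (mscale (c a) (nu a) : {measure set T -> \bar R}) | a <- enum A].
pose m_ := nth (mzero : {measure set T -> \bar R}) s.
have sumE (g : {measure set T -> \bar R} -> \bar R) :
    (\sum_(n < size s) g (m_ n) = \sum_a g (mscale (c a) (nu a)))%E.
  rewrite -(big_mkord xpredT (g \o m_)) -(big_nth _ xpredT g).
  by rewrite big_map big_enum.
rewrite (eq_measure_integral (msum m_ (size s))) => [|B mB BD].
  rewrite ge0_integral_measure_sum//.
  rewrite (sumE (fun m => \int[m]_(x in D) f x)%E).
  by apply: eq_bigr => a _; rewrite ge0_integral_mscale.
rewrite muE//; exact/esym/(sumE (fun m => m B)).
Qed.

Section value.
Context {R : realType} {A : finType} {M : mdp R A}.
Context {d : measure_display} {W : measurableType d} (X : trajectories M W).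
Implicit Types (p : policy R A) (a : A).

(** [traj_law] only measures events that fix every action up to a given time, so the event is
    partitioned by the action history [f] up to and including time [t]. *)
Lemma reward_distribution p t (B : set (measurableTypeR R)) : measurable B ->
  traj_prob X p (rew X t @^-1` B) = (\sum_a (p a)%:E * reward_law M a B)%E.
Proof.
move=> mB.
pose Bs s : set (measurableTypeR R) := if s == t then B else setT.
have mBs s : measurable (Bs s) by rewrite /Bs; case: eqP.
pose F (f : {ffun 'I_t.+1 -> A}) := \bigcap_(s < t.+1)
  [set w | act X s w = f (inord s) /\ Bs s (rew X s w)].
have mF f : measurable (F f).
  apply: fin_bigcap_measurable => // s _.
  apply: (measurableI (act X s @^-1` [set f (inord s)]) (rew X s @^-1` Bs s)).
    exact: act_measurable.
  rewrite -[X in measurable X]setTI; exact: measurable_funP.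
have -> : rew X t @^-1` B = \bigcup_(f in [set: {ffun 'I_t.+1 -> A}]) F f.
  apply/seteqP; split => [w /= Bw|w [f _ /(_ t (ltnSn t))]]; last first.
    by case=> _; rewrite /Bs eqxx.
  exists [ffun s : 'I_t.+1 => act X s w] => // s /= st.
  rewrite ffunE inordK//; split => //; rewrite /Bs; by case: eqP => // ->.
rewrite measure_fin_bigcup//; last 2 first.
- exact: finite_finset.
- apply/trivIsetP => f g _ _ fg; apply/seteqP; split => // w [Ff Fg].
  move/eqP: fg; apply; apply/ffunP => s.
  have [] := Ff s (ltn_ord s); have [] := Fg s (ltn_ord s).
  by rewrite inord_val => <- _ <-.
pose G (s : 'I_t.+1) a := p a * fine (reward_law M a (Bs s)).
rewrite (_ : \sum_(f \in _) _ =
    (\sum_(f : {ffun 'I_t.+1 -> A}) \prod_s G s (f s))%:E)%E; last first.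
  rewrite (fsbigE (enum {ffun 'I_t.+1 -> A})) ?enum_uniq//; last first.
    by move=> f _; rewrite /= mem_enum.
  rewrite big_enum_cond/= -sumEFin; apply: eq_big => f.
    by rewrite in_setT.
  move=> _; rewrite /F (traj_law X p t.+1 (fun s => f (inord s)))//.
  by congr EFin; apply: eq_bigr => s _; rewrite /G inord_val.
(* Distributivity turns the sum over histories into a product over times; before [t] the reward is
   unconstrained and each factor is the total mass of [p]. *)
rewrite -bigA_distr_bigA big_ord_recr/= big1 ?mul1r; last first.
  move=> i _; rewrite -(action_prob_sum1 p); apply: eq_bigr => a _.
  by rewrite /G /Bs/= ltn_eqF// probability_setT mulr1.
rewrite -sumEFin; apply: eq_bigr => a _.
rewrite /G /Bs eqxx EFinM fineK//; exact: fin_num_measure.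
Qed.

Lemma integral_reward a :
  (\int[reward_law M a]_(x in `[0%R, 1%R]) (x : R)%:E = (mean_reward M a)%:E)%E.
Proof.
have le01 : (0 <= \int[reward_law M a]_(x in `[0%R, 1%R]) (x : R)%:E <= 1)%E.
  apply/andP; split.
    by apply: integral_ge0 => x /=; rewrite in_itv/= lee_fin => /andP[].
  apply: (@le_trans _ _ (\int[reward_law M a]_(x in `[0%R, 1%R]) 1)%E).
    apply: ge0_le_integral => //.
    - by move=> x /=; rewrite in_itv/= lee_fin => /andP[].
    - by move=> x /=; rewrite in_itv/= lee_fin => /andP[].
  by rewrite integral_cst//= mul1e reward_law01.
rewrite /mean_reward unlock/=.
rewrite (_ : \int[_]_w _ =
    \int[reward_law M a]_(x in `[0%R, 1%R]) (x : R)%:E)%E.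
  rewrite fineK// ge0_fin_numE; case/andP: le01 => // _ /le_lt_trans; apply.
  exact: ltry.
(* The two integrands differ only outside [0, 1], a null set for the reward law. *)
rewrite [RHS]integral_mkcond; apply: ae_eq_integral => //.
- by apply/(measurable_restrictT _ _).1.
- exists (~` `[0, 1]); split.
  + by apply: measurableC.
  + have := @probability_setC _ _ _ (reward_law M a) `[0%R, 1%R]
      (measurable_itv _).
    by rewrite reward_law01 subee.
  + move=> x /= H; apply: contra_not H => xI _.
    by rewrite patchE mem_set.
Qed.

Lemma expectation_reward p t :
  ('E_(traj_prob X p)[rew X t])%E = (\sum_a p a * mean_reward M a)%:E.
Proof.
(* Integrating over this preimage makes the identity nonnegative on the domain after the change of
   variables. *)
have pre : rew X t @^-1` `[0, 1] = setT.
  by apply/seteqP; split => // w _ /=; rewrite in_itv/= rew_ge0 rew_le1.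
rewrite unlock -pre.
have mD : measurable (`[0, 1] : set (measurableTypeR R)).
  exact: measurable_itv.
have mX : measurable_fun setT (rew X t) by [].
rewrite -(@ge0_integral_pushforward _ _ _ _ _ _ mX _ _ EFin mD)//.
rewrite (ge0_integral_mixture (fun a => NngNum (action_prob_ge0 p a))
  _ (reward_law M))//.
- by rewrite -sumEFin; apply: eq_bigr => a _; rewrite integral_reward EFinM.
- by move=> x /=; rewrite in_itv/= lee_fin => /andP[].
- by move=> B mB _; exact: reward_distribution.
- by move=> x; rewrite inE/= in_itv/= lee_fin => /andP[].
Qed.

Lemma valueE p : V X p = (\sum_a p a * mean_reward M a) / (1 - discount M).
Proof.
have g0 := discount_gt0 M; have g1 := discount_lt1 M.
have gabs : `|discount M| < 1 by rewrite gtr0_norm.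
set m := \sum_a _.
rewrite /V unlock.
have -> : (\int[traj_prob X p]_w (discounted_return X w)%:E =
  \sum_(t <oo) \int[traj_prob X p]_w (discount M ^+ t * rew X t w)%:E)%E.
  rewrite -integral_nneseries//; last 2 first.
  - move=> t; apply/measurable_EFinP; apply: measurable_funM => //.
    exact: (measurable_funPT (rew X t)).
  - by move=> t w _; rewrite lee_fin mulr_ge0 ?rew_ge0 ?exprn_ge0// ltW.
  apply: eq_integral => w _; rewrite -EFin_lim.
    congr (limn _); apply/funext => n /=; by rewrite /series/= sumEFin.
  (* Real and extended limits agree only once the return converges; rewards at most 1 give
     domination by the geometric series. *)
  apply: (@series_le_cvg _ _ (geometric 1 (discount M))) => [t|t|t|].
  4: exact: is_cvg_geometric_series.
  - by rewrite mulr_ge0 ?rew_ge0 ?exprn_ge0// ltW.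
  - by rewrite mulr_ge0 ?exprn_ge0// ltW.
  - by rewrite /= mul1r ler_piMr ?rew_le1 ?exprn_ge0// ltW.
rewrite (_ : \sum_(t <oo) _ = (limn (series (geometric m (discount M))))%:E)%E.
  by rewrite /= (cvg_lim _ (@cvg_geometric_series _ m _ gabs)).
rewrite -EFin_lim; last exact: is_cvg_geometric_series.
congr (limn _); apply/funext => n /=; rewrite /series/= -sumEFin.
apply: eq_bigr => t _; under eq_integral do rewrite EFinM.
rewrite ge0_integralZl//; last 3 first.
- apply/measurable_EFinP; exact: (measurable_funPT (rew X t)).
- by move=> w _; rewrite lee_fin rew_ge0.
- by rewrite lee_fin exprn_ge0// ltW.
have := expectation_reward p t; rewrite unlock => ->.
by rewrite -EFinM mulrC.
Qed.

Lemma policy_card_gt0 p : (0 < #|A|)%N.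
Proof.
rewrite lt0n; apply/eqP => A0; have := action_prob_sum1 p.
rewrite big_pred0 => [/eqP|a]; first by rewrite eq_sym oner_eq0.
by have := card0_eq A0 a; rewrite !inE.
Qed.

(** Compare [p] with the policy that always plays [a]. Thus [(1 - discount M) * V X p] serves as the
    maximal mean reward. *)
Lemma optimal_value p a : optimal X p ->
  mean_reward M a <= (1 - discount M) * V X p.
Proof.
move=> popt.
have ge0 b : 0 <= (b == a)%:R :> R by [].
have sum1 : \sum_b (b == a)%:R = 1 :> R.
  by rewrite (bigD1 a)//= eqxx big1 ?addr0// => b /negPf ->.
have g1 : 0 < 1 - discount M by rewrite subr_gt0 discount_lt1.
have := popt (Policy ge0 sum1); rewrite valueE/= (bigD1 a)//= eqxx mul1r.
rewrite big1 ?addr0 => [|b /negPf ->]; last by rewrite mul0r.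
by rewrite ler_pdivrMr// mulrC.
Qed.

Lemma npg_softmax (eta : R) (pi : nat -> policy R A) k : npg X eta pi ->
  exists2 c, 0 < c &
    forall a, pi k a = c * expR (eta * k%:R * mean_reward M a).
Proof.
case=> pi0 piS; elim: k => [|k [c c0 IH]].
  exists #|A|%:R^-1; first by rewrite invr_gt0 ltr0n (policy_card_gt0 (pi 0%N)).
  by move=> a; rewrite pi0 mulr0 mul0r expR0 mulr1.
pose Z := \sum_a pi k a * expR (eta * Q X (pi k) a).
have Z0 : 0 < Z.
  rewrite lt0r sumr_ge0 ?andbT => [|a _]; last first.
    by rewrite mulr_ge0 ?action_prob_ge0 ?expR_ge0.
  (* Division by zero returns 0, so [Z = 0] would make [pi k.+1] vanish identically. *)
  apply/eqP => Z0; have := action_prob_sum1 (pi k.+1).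
  under eq_bigr do rewrite piS -/Z Z0 invr0 mulr0.
  by rewrite big1_eq => /eqP; rewrite eq_sym oner_eq0.
exists (c * expR (eta * (discount M * V X (pi k))) / Z).
  by rewrite divr_gt0 ?mulr_gt0 ?expR_gt0.
move=> a; rewrite piS -/Z IH /Q mulrDr expRD -natr1 [eta * (_ + 1)]mulrDr.
rewrite mulr1 mulrDl expRD.
ring.
Qed.

Lemma npg_prob_ge (eta S : R) (pi : nat -> policy R A) k a : 0 <= eta ->
  npg X eta pi -> (forall b, mean_reward M b <= S) ->
  expR (- (eta * (S - mean_reward M a) * k%:R)) / #|A|%:R <= pi k a.
Proof.
move=> eta0 /(npg_softmax _ _ k) [c c0 piE] rS.
rewrite ler_pdivrMr; last by rewrite ltr0n (policy_card_gt0 (pi 0%N)).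
(* The probabilities sum to 1 and each is at most [c * expR (eta * k%:R * S)]; this bounds [c] from
   below. *)
have c1 : 1 <= c * #|A|%:R * expR (eta * k%:R * S).
  have -> : c * #|A|%:R * expR (eta * k%:R * S) =
      \sum_(b : A) c * expR (eta * k%:R * S).
    by rewrite mulrAC [LHS]mulr_natr sumr_const; congr (_ *+ _); exact: eq_card.
  rewrite -[leLHS](action_prob_sum1 (pi k)).
  apply: ler_sum => b _; rewrite piE ler_pM2l// ler_expR.
  by apply: ler_wpM2l (rS b); rewrite mulr_ge0.
rewrite piE -[leLHS]mul1r.
apply: le_trans (ler_wpM2r (expR_ge0 _) c1) _.
rewrite -[leLHS]mulrA -expRD mulrAC.
by rewrite [X in expR X](_ : _ = eta * k%:R * mean_reward M a)//; ring.
Qed.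

(** By [valueE], the difference times [1 - discount M] is a [q]-average of terms that are
    nonnegative by [optimal_value]; only the term of [a] is kept. *)
Lemma value_sub_ge p (q : policy R A) a : optimal X p ->
  ((1 - discount M) * V X p - mean_reward M a) / (1 - discount M) * q a
  <= V X p - V X q.
Proof.
move=> popt; set g := 1 - discount M.
have g0 : 0 < g by rewrite subr_gt0 discount_lt1.
rewrite mulrAC ler_pdivrMr// [V X q]valueE -/g [leRHS]mulrBl divfK ?gt_eqF//.
rewrite -[V X p * g]mul1r -(action_prob_sum1 q) mulr_suml -sumrB (bigD1 a)//=.
rewrite -mulrBr mulrC [V X p * g]mulrC lerDl sumr_ge0// => b _.
by rewrite -mulrBr mulr_ge0 ?action_prob_ge0// subr_ge0 optimal_value.
Qed.

Lemma gap_cases p : gap X p = +oo%E \/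
  exists a, gap X p = ((1 - discount M) * V X p - mean_reward M a)%:E.
Proof.
rewrite /gap; case: (pickP [pred a | a \notin greedy X p]) => [a0 Ha0|no].
  right; have [a _ ->] :=
    eq_bigmax a0 _ (fun a => (advantage X p a)%:E) Ha0 (fun a _ => leNye _).
  by exists a; rewrite -EFinN /advantage /Q; congr EFin; ring.
by left; rewrite big_pred0.
Qed.

End value.

(* The bound is read in the extended reals, with +oo * 0 = 0 and exp(-oo) = 0.
   When every action is optimal and K = 0 it would read 0 >= +oo, so exactly
   that case is excluded. *)
Theorem proposition3p1 (R : realType) (A : finType) (M : mdp R A)
    (d : measure_display) (W : measurableType d) (X : trajectories M W)
    (eta : R) (pi : nat -> policy R A) (pistar : policy R A) :
  0 < eta ->
  npg X eta pi ->
  optimal X pistar ->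
  forall K : nat,
  (gap X pistar = +oo%E -> (0 < K)%N) ->
  (gap X pistar * (((1 - discount M) * #|A|%:R)^-1)%:E
     * expeR (- (eta%:E * gap X pistar * K%:R%:E))
   <= (V X pistar - V X (pi K))%:E)%E.
Proof.
move=> eta0 npgpi popt K gapK.
have [gapy|[a ->]] := gap_cases X pistar.
  (* Since [K] is positive the exponent is -oo, so the left side is +oo * 0 = 0 and optimality
     suffices. *)
  have K0 := gapK gapy; rewrite gapy.
  have -> : (eta%:E * +oo * K%:R%:E = +oo)%E.
    by rewrite gt0_muley ?lte_fin// gt0_mulye// lte_fin ltr0n.
  by rewrite mule0 lee_fin subr_ge0 popt.
rewrite -!EFinM lee_fin.
set S := (1 - discount M) * V X pistar.
have g0 : 0 < 1 - discount M by rewrite subr_gt0 discount_lt1.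
have rS b : mean_reward M b <= S by exact: optimal_value popt.
apply: le_trans (value_sub_ge X pistar (pi K) a popt); rewrite -/S invfM.
rewrite [X in X <= _](_ : _ = (S - mean_reward M a) / (1 - discount M) *
  (expR (- (eta * (S - mean_reward M a) * K%:R)) / #|A|%:R)); last by ring.
apply: ler_wpM2l; first by rewrite divr_ge0 ?(ltW g0)// subr_ge0.
exact: npg_prob_ge _ _ _ _ _ _ (ltW eta0) npgpi rS.
Qed.
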